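(* Let $T$ be a tree on $n\ge 4$ vertices. Then \[\left\lceil\frac{n+1}{3}\right\rceil \le f(T)\le \left\lfloor\frac{2(n-1)}{3}\right\rfloor.\] Furthermore, these bounds are best possible: there are infinitely many trees attaining the lower bound with equality, and infinitely many trees attaining the upper bound with equality.
   Context: For a graph $G$, a family $\mathcal{P}$ of subsets of $E(G)$ is a separating path system of $G$ if every member of $\mathcal{P}$ is (the edge set of) a path in $G$, and for every pair of distinct edges $e,e'\in E(G)$ there is some $P\in\mathcal{P}$ containing exactly one of $e,e'$. $f(G)$ denotes the minimum size of a separating path system of $G$. *)

(* Defs.v *)
From HB Require Import structures.
From mathcomp Require Import all_boot.
From mathcomp Require Import boolp.

Set Implicit Arguments.
Unset Strict Implicit.
Unset Printing Implicit Defensive.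

Record sgraph := SGraph {
  vert :> finType;
  adj : rel vert;
  adj_sym : symmetric adj;
  adj_irr : irreflexive adj }.

Section Graphs.
Variable G : sgraph.

Definition edges : {set {set G}} :=
  [set [set p.1; p.2] | p in [pred p : G * G | adj p.1 p.2]].

Definition seq_edges (s : seq G) : {set {set G}} :=
  [set [set p.1; p.2] | p in zip s (behead s)].

Definition is_path (P : {set {set G}}) : Prop :=
  exists (x : G) (s : seq G),
    [/\ uniq (x :: s), path (@adj G) x s & P = seq_edges (x :: s)].

Definition separating_path_system (F : {set {set {set G}}}) : Prop :=
  (forall P, P \in F -> is_path P) /\
  (forall e1 e2, e1 \in edges -> e2 \in edges -> e1 != e2 ->
     exists2 P, P \in F & (e1 \in P) != (e2 \in P)).

Lemma sps_exists :
  exists k, `[< exists F, separating_path_system F /\ #|F| = k >].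
Proof.
exists #|[set [set e] | e in edges]|; apply/asboolP.
exists [set [set e] | e in edges]; split => //; split.
- move=> P /imsetP [e /imsetP [[x y] /=]]; rewrite inE /= => Hxy -> ->.
  exists x, [:: y]; split.
  + by rewrite /= inE andbT; apply/eqP => Exy; move: Hxy; rewrite Exy (adj_irr).
  + by rewrite /= Hxy.
  + apply/setP => f; rewrite /seq_edges /=.
    apply/idP/idP.
    * by rewrite inE => /eqP ->; apply/imsetP; exists (x, y) => //; rewrite inE.
    * by case/imsetP => p; rewrite inE => /eqP -> ->; rewrite inE.
- move=> e1 e2 H1 _ Hne; exists [set e1]; first by apply/imsetP; exists e1.
  by rewrite !inE eqxx; move: Hne; rewrite eq_sym; case: (e2 == e1).
Qed.

Definition f : nat := ex_minn sps_exists.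

Definition connected : Prop := forall x y : G, connect (@adj G) x y.
Definition acyclic : Prop :=
  forall s : seq G, uniq s -> 3 <= size s -> ~~ cycle (@adj G) s.
Definition is_tree : Prop := 0 < #|G| /\ connected /\ acyclic.

End Graphs.

(* Main.v *)
(** Upper bound: grow the tree leaf by leaf.  Any three edges of a tree can be
named a, b, c so that one path contains a, b but not c and another contains
b, c but not a; hence two new paths suffice for every three new edges, as
long as all the old edges were covered.  This gives a covering separating
system of 2t paths for 3t edges, and one or two more edges cost nothing or
one path.

Lower bound: if k paths separate the edges, some path ends at each vertex of
degree 2, and each leaf is the end of at least two paths, with two kinds of
exceptions: at most one leaf is missed altogether, and at most k leaves are
the end of a single path, as two of these on the same path could not be
separated.  Counting the 2k ends gives 2 n_1 + n_2 <= 3k + 2, while the degree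
sum of a tree gives n + 2 <= 2 n_1 + n_2.  The last unit is gained around the
neighbour of the missed leaf.

The upper bound is attained by stars with 3t + 1 leaves, and the lower bound
by caterpillars whose spine edges are crossed by the k paths 0 ... j first and
j ... k - 1 afterwards. *)
Require Import Defs.
From mathcomp Require Import all_boot.
From mathcomp Require Import boolp zify.

Set Implicit Arguments.
Unset Strict Implicit.
Unset Printing Implicit Defensive.

Lemma card_setU1_leq (T : finType) (x : T) (A : {set T}) : #|x |: A| <= #|A|.+1.
Proof. by rewrite cardsU1 -add1n leq_add2r leq_b1. Qed.

(** * Edges along a sequence of vertices *)

Section PathEdges.
Variable G : sgraph.
Implicit Types (s t : seq G) (x y u v : G) (e : {set G}).

Lemma set2_inj x y u v :
  [set x; y] = [set u; v] -> (x = u /\ y = v) \/ (x = v /\ y = u).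
Proof.
move=> E.
have := set21 x y; have := set22 x y; rewrite E !inE.
have := set21 u v; have := set22 u v; rewrite -E !inE.
by do 4![case/orP=> /eqP ?]; subst; auto.
Qed.

Lemma mem_edges x y : ([set x; y] \in edges G) = adj x y.
Proof.
apply/imsetP/idP => [[[u v]]|xy]; last by exists (x, y).
rewrite inE /= => uv /set2_inj [] [-> ->] //.
by rewrite adj_sym.
Qed.

Lemma edgesP e : reflect (exists2 p : G * G, adj p.1 p.2 & e = [set p.1; p.2])
  (e \in edges G).
Proof. by apply: (iffP imsetP) => -[p]; exists p. Qed.

Lemma edges_at e u :
  e \in edges G -> u \in e -> exists2 v, adj u v & e = [set u; v].
Proof.
case/edgesP => -[x y] /= xy ->; rewrite !inE => /orP [] /eqP ->.
  by exists y.
by exists x; rewrite 1?adj_sym // setUC.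
Qed.

(** List form of [seq_edges]: the order of the edges is needed to cut a path at one of them. *)
Definition edge_seq s : seq {set G} :=
  [seq [set p.1; p.2] | p <- zip s (behead s)].

Lemma mem_seq_edges s e : (e \in seq_edges s) = (e \in edge_seq s).
Proof. by apply/imsetP/mapP => -[p ps ->]; exists p. Qed.

Lemma edge_seq_cons x y s :
  edge_seq (x :: y :: s) = [set x; y] :: edge_seq (y :: s).
Proof. by []. Qed.

Lemma edge_seq_cat s u t :
  edge_seq (s ++ u :: t) = edge_seq (rcons s u) ++ edge_seq (u :: t).
Proof.
elim: s => [//|x s IH]; case: s IH => [//|y s] IH.
by move: IH; rewrite /edge_seq /= => ->.
Qed.

Lemma edge_seq_rcons s u v :
  edge_seq (rcons (rcons s u) v) = rcons (edge_seq (rcons s u)) [set u; v].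
Proof. by rewrite -(cats1 _ v) cat_rcons edge_seq_cat /= cats1. Qed.

Lemma edge_seq_rev s : edge_seq (rev s) = rev (edge_seq s).
Proof.
elim: s => [//|x s IH]; case: s IH => [//|y s] IH.
rewrite rev_cons rev_cons edge_seq_rcons -rev_cons IH setUC.
by rewrite -rev_cons.
Qed.

Lemma edge_seq_split s e : e \in edge_seq s ->
  exists s1 u v s2, s = s1 ++ u :: v :: s2 /\ e = [set u; v].
Proof.
elim: s => [//|x s IH]; case: s IH => [//|y s] IH.
rewrite edge_seq_cons inE => /orP [/eqP ->|/IH [s1 [u [v [s2 [-> ->]]]]]].
  by exists [::], x, y, s.
by exists (x :: s1), u, v, s2.
Qed.

Lemma edge_seq_sub s e x : e \in edge_seq s -> x \in e -> x \in s.
Proof.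
case/edge_seq_split => s1 [u [v [s2 [-> ->]]]].
by rewrite !mem_cat !inE => /orP [] /eqP ->; rewrite eqxx ?orbT.
Qed.

Lemma edge_seq_uniq s : uniq s -> uniq (edge_seq s).
Proof.
elim: s => [//|x s IH]; case: s IH => [//|y s] IH /andP [xs us].
rewrite /= -/(edge_seq (y :: s)) IH // andbT.
by apply: contra xs => /edge_seq_sub; apply; rewrite set21.
Qed.

Lemma edge_seq_path x s :
  {subset edge_seq (x :: s) <= edges G} -> path (@adj G) x s.
Proof.
elim: s x => [//|y s IH] x sub /=; apply/andP; split.
  by rewrite -mem_edges; apply: sub; rewrite mem_head.
by apply: IH => e es; apply: sub; rewrite inE es orbT.
Qed.

Lemma path_edge_seq x s :
  path (@adj G) x s -> {subset edge_seq (x :: s) <= edges G}.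
Proof.
elim: s x => [//|y s IH] x /= /andP [xy ys] e.
rewrite inE => /orP [/eqP ->|]; first by rewrite mem_edges.
exact: IH.
Qed.

End PathEdges.

(** * Subtrees grown by adding leaves *)

Section Grown.
Variable G : sgraph.
Implicit Types (s t : seq G) (x y u v : G) (e : {set G}) (E : {set {set G}}).

(* [E] is the edge set of a subtree on the vertices [s], each of which was
   added as a leaf to the subtree on the vertices that follow it in [s]. *)
Inductive grown : seq G -> {set {set G}} -> Prop :=
| Grown1 r : grown [:: r] set0
| GrownS x y s E : grown s E -> x \notin s -> y \in s -> adj x y ->
    grown (x :: s) ([set x; y] |: E).

Lemma grown_uniq s E : grown s E -> uniq s.
Proof. by elim=> //= x y {}s {}E _ -> ->. Qed.

Lemma grown_edges s E : grown s E -> E \subset edges G.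
Proof.
elim=> [r|x y {}s {}E _ IH _ _ xy]; first exact: sub0set.
by rewrite subUset IH sub1set mem_edges xy.
Qed.

Lemma grown_sub s E e x : grown s E -> e \in E -> x \in e -> x \in s.
Proof.
move=> g; elim: g e x => [r e x|u v {}s {}E _ IH _ vs _ e x]; rewrite !inE //.
case/orP=> [/eqP ->|eE xe]; last by rewrite (IH _ _ eE xe) orbT.
by rewrite !inE => /orP [] /eqP ->; rewrite ?eqxx // vs orbT.
Qed.

Lemma grown_new s E x y : grown s E -> x \notin s -> [set x; y] \notin E.
Proof. by move=> g; apply: contra => /(grown_sub g); apply; rewrite set21. Qed.

Lemma card_grown s E : grown s E -> #|E|.+1 = size s.
Proof.
elim=> [r|x y {}s {}E g IH xs _ _]; first by rewrite cards0.
by rewrite cardsU1 (grown_new _ g xs) /= -IH.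
Qed.

(** A path of the subtree. Adjacency follows from the last clause once [E] consists of edges; the
    second clause keeps a leaf added later off the walk. *)
Definition walk s E t :=
  [/\ uniq t, {subset t <= s} & {subset edge_seq t <= E}].

Lemma walk_weak s E x e t : walk s E t -> walk (x :: s) (e |: E) t.
Proof.
case=> ut ts tE; split=> // z; last by move/tE; rewrite !inE orbC => ->.
by move/ts; rewrite inE orbC => ->.
Qed.

Lemma walk_cons s E x y t : x \notin s ->
  walk s E (y :: t) -> walk (x :: s) ([set x; y] |: E) (x :: y :: t).
Proof.
move=> xs w; have [ut ts tE] := w; have [_ ts' tE'] := walk_weak x [set x; y] w.
split.
- by rewrite cons_uniq ut andbT; apply: contra xs => /ts.
- by move=> z; rewrite inE => /orP [/eqP ->|/ts' //]; rewrite mem_head.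
- move=> e; rewrite edge_seq_cons inE => /orP [/eqP ->|/tE' //].
  by rewrite setU11.
Qed.

Lemma walk_rev s E t : walk s E t -> walk s E (rev t).
Proof.
case=> ut ts tE; split; first by rewrite rev_uniq.
- by move=> z; rewrite mem_rev => /ts.
- by move=> z; rewrite edge_seq_rev mem_rev => /tE.
Qed.

Lemma walk_rcons s E x y t : x \notin s -> walk s E (rcons t y) ->
  walk (x :: s) ([set x; y] |: E) (rcons (rcons t y) x).
Proof.
move=> xs /walk_rev; rewrite rev_rcons => /(walk_cons xs) /walk_rev.
by rewrite !rev_cons revK.
Qed.

Lemma walk_is_path s E x t : grown s E -> walk s E (x :: t) ->
  is_path (seq_edges (x :: t)) /\ seq_edges (x :: t) \subset E.
Proof.
move=> g [ut ts tE]; split.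
  exists x, t; split=> //; apply: edge_seq_path => e /tE.
  exact/subsetP/grown_edges/g.
by apply/subsetP => e; rewrite mem_seq_edges => /tE.
Qed.

Lemma grown_connect s E u v : grown s E -> u \in s -> v \in s ->
  exists t, walk s E (u :: t) /\ last u t = v.
Proof.
move=> g; elim: g u v => [r|x y {}s {}E g IH xs ys xy] u v.
  rewrite !inE => /eqP -> /eqP ->; by exists [::]; split=> //; split.
rewrite !inE => /orP [/eqP ->|us] /orP [/eqP ->|vs].
- by exists [::]; split=> //; split=> // z; rewrite !inE => ->.
- have [t [w <-]] := IH _ _ ys vs; exists (y :: t).
  by split=> //; apply: walk_cons.
- have [t [w lt]] := IH _ _ us ys; exists (rcons t x); rewrite last_rcons.
  split=> //; have := @walk_rcons s E x y (belast u t) xs.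
  by rewrite -lt -lastI rcons_cons; apply.
- by have [t [w <-]] := IH _ _ us vs; exists t; split=> //; apply: walk_weak.
Qed.

(** Induction on the added leaves: if the new leaf is the start, or its edge is the target, a walk
    of the smaller subtree is prolonged at [y]. *)
Lemma grown_walk_to_edge s E u b : grown s E -> u \in s -> b \in E ->
  exists t l, walk s E (u :: t) /\ edge_seq (u :: t) = rcons l b.
Proof.
move=> g; elim: g u b => [r u b _|x y {}s {}E g IH xs ys xy u b].
  by rewrite inE.
rewrite !inE => /orP [/eqP ->|us] /orP [/eqP ->|bE].
- exists [:: y], [::]; split=> //; apply: walk_cons => //.
  by split=> // z; rewrite inE => /eqP ->.
- have [t [l [w lt]]] := IH _ _ ys bE; exists (y :: t), ([set x; y] :: l).
  by split; [apply: walk_cons | rewrite rcons_cons -lt].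
- have [t [w lt]] := grown_connect g us ys.
  exists (rcons t x), (edge_seq (u :: t)).
  rewrite -rcons_cons (lastI u t) lt; split.
    by apply: walk_rcons => //; rewrite -lt -lastI.
  by rewrite edge_seq_rcons (setUC [set x]).
- have [t [l [w lt]]] := IH _ _ us bE; exists t, l.
  by split=> //; apply: walk_weak.
Qed.

(** If one of the two edges is new, it is followed by a walk from [y] to the other; reversal covers
    the case where [b] is the new one. *)
Lemma grown_walk_edges s E a b : grown s E -> a \in E -> b \in E -> a != b ->
  exists x t l, walk s E (x :: t) /\ edge_seq (x :: t) = a :: rcons l b.
Proof.
move=> g; elim: g a b => [r a b|x y {}s {}E g IH xs ys xy a b].
  by rewrite inE.
have new c : c \in E -> exists t l,
    walk (x :: s) ([set x; y] |: E) (x :: y :: t) /\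
    edge_seq (x :: y :: t) = [set x; y] :: rcons l c.
  move=> cE; have [t [l [w lt]]] := grown_walk_to_edge g ys cE.
  by exists t, l; rewrite -lt; split=> //; apply: walk_cons.
rewrite !inE => /orP [/eqP ->|aE] /orP [/eqP ->|bE]; first by rewrite eqxx.
- by move=> _; have [t [l H]] := new _ bE; exists x, (y :: t), l.
- move=> _; have [t [l [/walk_rev w lt]]] := new _ aE.
  have := edge_seq_rev [:: x, y & t].
  rewrite lt (rev_cons [set x; y]) rev_rcons rcons_cons.
  case: (rev _) w => [//|z t'] w lt'; exists z, t', (rev l); split=> //.
- move=> ab; have [z [t [l [w lt]]]] := IH _ _ aE bE ab; exists z, t, l.
  by split=> //; apply: walk_weak.
Qed.

(** * Separating systems that cover every edge of a subtree *)

Definition path_in E P := is_path P /\ P \subset E.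

(** With respect to [P] and [Q] the edges [a], [b], [c] have the codes 10, 11, 01, which are
    distinct and nonzero; [b] is the shared edge. *)
Definition linked E a b c := exists P Q, [/\ path_in E P, path_in E Q,
  [/\ a \in P, b \in P & c \notin P] & [/\ b \in Q, c \in Q & a \notin Q]].

(** The path from [a] to [b] is cut at [c]: the part up to and including [c] misses [b], the part
    from [c] on misses [a]. *)
Lemma walk_linked s E x t a b c l : grown s E -> walk s E (x :: t) ->
  edge_seq (x :: t) = a :: rcons l b -> c != a -> c != b ->
  c \in seq_edges (x :: t) -> linked E a c b.
Proof.
move=> g [ut ts tE] lt ca cb; rewrite mem_seq_edges.
case/edge_seq_split => s1 [u [v [s2 [xt ce]]]].
have [e1 e2] : edge_seq (rcons (rcons s1 u) v) = rcons (edge_seq (rcons s1 u)) c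
    /\ edge_seq (x :: t) = edge_seq (rcons s1 u) ++ c :: edge_seq (v :: s2).
  by rewrite xt edge_seq_cat edge_seq_rcons ce.
have := edge_seq_uniq ut.
rewrite {1}e2 cat_uniq /= => /and3P [_ /norP [c1 /hasPn d] /andP [c2 _]].
have a1 : a \in edge_seq (rcons s1 u).
  move: e2; rewrite lt; case: (edge_seq (rcons s1 u)) => [|a' l'] /= [aa _].
    by rewrite aa eqxx in ca.
  by rewrite aa mem_head.
have b1 : b \in edge_seq (v :: s2).
  move: e2; rewrite lt; case/lastP: (edge_seq (v :: s2)) => [|l' b'].
    rewrite cats1 -rcons_cons => /rcons_inj [_ bc].
    by rewrite bc eqxx in cb.
  by rewrite -rcons_cons -rcons_cons -rcons_cat => /rcons_inj [_ ->];
     rewrite mem_rcons mem_head.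
have pre : walk s E (rcons (rcons s1 u) v).
  split.
  - move: ut; rewrite xt -cat_rcons -cat_rcons cat_uniq => /andP [] //.
  - move=> z zt; apply: ts; rewrite xt -cat_rcons -cat_rcons mem_cat zt //.
  - move=> z; rewrite e1 => zt; apply: tE; rewrite e2 mem_cat inE.
    by move: zt; rewrite mem_rcons inE => /orP [->|->]; rewrite ?orbT.
have suf : walk s E (u :: v :: s2).
  split.
  - by move: ut; rewrite xt cat_uniq => /and3P [].
  - by move=> z zt; apply: ts; rewrite xt mem_cat zt orbT.
  - move=> z zt; apply: tE; rewrite e2 mem_cat.
    by move: zt; rewrite edge_seq_cons -ce => ->; rewrite orbT.
exists (seq_edges (rcons (rcons s1 u) v)), (seq_edges (u :: v :: s2)).
rewrite !mem_seq_edges e1 edge_seq_cons -ce !mem_rcons !inE !eqxx a1 b1.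
rewrite !orbT (eq_sym b) (eq_sym a) (negPf ca) (negPf cb) /=.
split=> //; last 2 first.
- by split=> //; apply: d.
- by split=> //; apply/negP => /d; rewrite a1.
- move: pre; case: (rcons _ v) (size_rcons (rcons s1 u) v) => // ? ? _.
  by apply: walk_is_path.
- exact: walk_is_path g suf.
Qed.

(** Take the paths from [a] to [b] and from [b] to [c]. If one of them contains the third edge, it
    is cut there; otherwise the two paths themselves share [b] and do the job. *)
Lemma grown_linked s E a b c : grown s E -> a \in E -> b \in E -> c \in E ->
  a != b -> b != c -> a != c ->
  [\/ linked E a b c, linked E a c b | linked E b a c].
Proof.
move=> g aE bE cE ab bc ac.
have [x [t [l [w lt]]]] := grown_walk_edges g aE bE ab.
have [x' [t' [l' [w' lt']]]] := grown_walk_edges g bE cE bc.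
case: (boolP (c \in seq_edges (x :: t))) => cP.
  by apply: Or32; apply: walk_linked g w lt _ _ cP; rewrite eq_sym.
case: (boolP (a \in seq_edges (x' :: t'))) => aQ.
  by apply: Or33; apply: walk_linked g w' lt' ab ac aQ.
apply: Or31; exists (seq_edges (x :: t)), (seq_edges (x' :: t')).
split; [exact: walk_is_path g w | exact: walk_is_path g w' | |];
  by split=> //; rewrite mem_seq_edges ?lt ?lt' !(inE, mem_rcons) eqxx ?orbT.
Qed.

Definition separates (F : {set {set {set G}}}) E := forall e1 e2,
  e1 \in E -> e2 \in E -> e1 != e2 -> exists2 P, P \in F & (e1 \in P) != (e2 \in P).

(** Covering makes the induction work: an edge outside [E] lies in no member of [F], so it is
    already separated from all of [E]. *)
Definition covering_system (F : {set {set {set G}}}) E :=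
  [/\ forall P, P \in F -> path_in E P, E \subset cover F & separates F E].

Lemma path_in_weak E E' P : E \subset E' -> path_in E P -> path_in E' P.
Proof. by move=> EE' [pP sP]; split=> //; apply: subset_trans EE'. Qed.

Lemma covering_new F E e e' : covering_system F E -> e \in E -> e' \notin E ->
  exists2 P, P \in F & (e \in P) != (e' \in P).
Proof.
move=> [pF cF _] eE e'E; have /bigcupP [P PF eP] := subsetP cF _ eE.
exists P => //; rewrite eP; have [_ /subsetP PE] := pF _ PF.
by apply: contra e'E => /eqP /esym /PE.
Qed.

(** Old edges are separated from new ones by covering, and the three new edges from each other by
    their codes on [P] and [Q]. *)
Lemma covering_extend F E a b c :
  covering_system F E -> a \notin E -> b \notin E -> c \notin E ->
  linked (a |: (b |: (c |: E))) a b c ->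
  exists2 F', covering_system F' (a |: (b |: (c |: E))) & #|F'| <= #|F| + 2.
Proof.
move=> covF aE bE cE; have [pF cF sF] := covF.
case=> [P [Q [pP pQ [aP bP cP] [bQ cQ aQ]]]].
set E' := a |: _ in pP pQ *.
have EE' : E \subset E' by apply/subsetP => e eE; rewrite !inE eE !orbT.
exists (P |: (Q |: F)); last first.
  rewrite addn2; apply: leq_trans (card_setU1_leq _ _) _.
  exact: card_setU1_leq.
have PF : P \in P |: (Q |: F) by rewrite !inE eqxx.
have QF : Q \in P |: (Q |: F) by rewrite !inE eqxx orbT.
have FF R : R \in F -> R \in P |: (Q |: F) by rewrite !inE => ->; rewrite !orbT.
have old e e' : e \in E -> e' \notin E ->
    exists2 R, R \in P |: (Q |: F) & (e \in R) != (e' \in R).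
  by move=> eE /(covering_new covF eE) [R /FF]; exists R.
have old' e e' : e \notin E -> e' \in E ->
    exists2 R, R \in P |: (Q |: F) & (e \in R) != (e' \in R).
  by move=> /old H /H [R RF]; exists R; rewrite // eq_sym.
split.
- move=> R; rewrite !inE => /or3P [/eqP ->|/eqP ->|/pF] //.
  exact: path_in_weak.
- apply/subsetP => e; rewrite !inE => /or4P [/eqP ->|/eqP ->|/eqP ->|eE];
    apply/bigcupP; [by exists P | by exists P | by exists Q |].
  by have /bigcupP [R RF eR] := subsetP cF _ eE; exists R; first exact: FF.
- move=> e e'; rewrite !inE => /or4P He /or4P He'.
  case: He => [/eqP ->|/eqP ->|/eqP ->|eE];
    case: He' => [/eqP ->|/eqP ->|/eqP ->|e'E] ne;
    (try by rewrite eqxx in ne); (try exact: old); (try exact: old').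
  + by exists Q; rewrite // bQ (negPf aQ).
  + by exists P; rewrite // aP (negPf cP).
  + by exists Q; rewrite // bQ (negPf aQ).
  + by exists P; rewrite // bP (negPf cP).
  + by exists P; rewrite // aP (negPf cP).
  + by exists P; rewrite // bP (negPf cP).
  by have [R RF] := sF _ _ eE e'E ne; exists R; first exact: FF.
Qed.

(** The subtree has [3 * t] edges; each induction step strips the three leaves added last. *)
Lemma grown_covering (t : nat) s E : grown s E -> size s = 3 * t + 1 ->
  exists2 F, covering_system F E & #|F| <= 2 * t.
Proof.
elim: t s E => [|t IH] s E g.
  case: g => [r _|x y {}s {}E g _ _ _]; last by have := card_grown g; rewrite /=; lia.
  exists set0; last by rewrite cards0.
  by split=> [P||e e']; rewrite ?inE ?sub0set.
move=> sz; case: g sz => [r|x x' s1 E1 g1 xs xs' xx']; rewrite /=; first lia.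
case: g1 xs xs' => [r|y y' s2 E2 g2 ys ys' yy' xs xs']; rewrite /=; first lia.
case: g2 ys ys' xs xs' => [r|z z' s3 E3 g3 zs zs' zz' ys ys' xs xs'];
  rewrite /=; first lia.
move=> sz; have [F cF Ft] := IH _ _ g3 ltac:(lia).
have g2 := GrownS g3 zs zs' zz'; have g1 := GrownS g2 ys ys' yy'.
have g := GrownS g1 xs xs' xx'.
have Hx := grown_new x' g1 xs; have Hy := grown_new y' g2 ys.
have Hz := grown_new z' g3 zs.
move: Hx Hy g; set a := [set x; x']; set b := [set y; y']; set c := [set z; z'].
rewrite !inE !negb_or => /and3P [ab ac aE] /andP [bc bE] g.
have [aI bI cI] : [/\ a \in a |: (b |: (c |: E3)), b \in a |: (b |: (c |: E3))
   & c \in a |: (b |: (c |: E3))] by rewrite !inE !eqxx !orbT.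
have Ft' k : k <= #|F| + 2 -> k <= 2 * t.+1 by move: Ft; clear; lia.
(* The new edges are reordered so that the shared one stands second. *)
case: (grown_linked g aI bI cI ab bc ac) => L.
- by have [F' ? /Ft'] := covering_extend cF aE bE Hz L; exists F'.
- rewrite (setUCA [set b]) in L *.
  by have [F' ? /Ft'] := covering_extend cF aE Hz bE L; exists F'.
- rewrite (setUCA [set a]) in L *.
  by have [F' ? /Ft'] := covering_extend cF bE aE Hz L; exists F'.
Qed.

(** By the number of edges modulo 3. One extra edge may stay uncovered, as the only edge with empty
    code; of two extra edges, one becomes a path by itself and the other stays uncovered. The sizes
    are [2 * t], [2 * t] and [2 * t + 1]. *)
Lemma grown_separating s E : grown s E ->
  exists F : {set {set {set G}}}, [/\ forall P, P \in F -> path_in E P, separates F E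
              & #|F| <= (2 * (size s - 1)) %/ 3].
Proof.
move=> g; have := divn_eq (size s - 1) 3; have := ltn_pmod (size s - 1) (isT : 0 < 3).
have := card_grown g.
move: ((size s - 1) %/ 3) => t; case: (_ %% 3) => [|[|[|//]]] sz _ Dt.
- have [F covF Ft] := grown_covering (t := t) g ltac:(lia).
  have [pF cF sF] := covF.
  by exists F; split=> //; apply: (leq_trans Ft); rewrite Dt leq_divRL //; clear; lia.
- move: sz Dt; case: g => [r|x y {}s {}E g xs ys xy] /= sz Dt; first by lia.
  have [F covF Ft] := grown_covering (t := t) g ltac:(lia).
  have [pF cF sF] := covF.
  have EE : E \subset [set x; y] |: E by apply/subsetP => e eE; rewrite !inE eE !orbT.
  exists F; split; [by move=> P /pF; exact: path_in_weak | |].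
  2: by apply: (leq_trans Ft); rewrite Dt leq_divRL //; clear; lia.
  have old e : e \in E -> exists2 R, R \in F & (e \in R) != ([set x; y] \in R).
    by move=> eE; apply: covering_new covF eE (grown_new y g xs).
  move=> e e'; rewrite !inE => /orP [/eqP ->|eE] /orP [/eqP ->|e'E] ne.
  + by rewrite eqxx in ne.
  + by have [R RF] := old _ e'E; exists R; rewrite // eq_sym.
  + exact: old.
  + exact: sF.
- move: sz Dt; case: g => [r|x y s1 E1 g1 xs ys xy] /= sz Dt; first by lia.
  move: sz Dt xs ys; case: g1 => [r|u v s2 E2 g us vs uv] /= sz Dt xs ys; first by lia.
  have [F covF Ft] := grown_covering (t := t) g ltac:(lia).
  have [pF cF sF] := covF.
  have g1 := GrownS g us vs uv; have gg := GrownS g1 xs ys xy.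
  have := grown_new y g1 xs; have := grown_new v g us.
  move: gg; set a := [set x; y]; set b := [set u; v] => gg bE.
  rewrite !inE negb_or => /andP [ab aE].
  have EE : E2 \subset a |: (b |: E2) by apply/subsetP => e eE; rewrite !inE eE !orbT.
  have pa : path_in (a |: (b |: E2)) [set a].
    have [|] := walk_is_path (x := x) (t := [:: y]) gg.
      by apply: walk_cons => //; split=> // z; rewrite inE => /eqP ->.
    have -> // : seq_edges [:: x; y] = [set a].
    by apply/setP => e; rewrite mem_seq_edges !inE.
  have FF R : R \in F -> R \in [set a] |: F by rewrite !inE => ->; rewrite orbT.
  exists ([set a] |: F); split.
  + by move=> P; rewrite !inE => /orP [/eqP ->|/pF] //; exact: path_in_weak.
  + have old e c : e \in E2 -> c \notin E2 ->
        exists2 R, R \in [set a] |: F & (e \in R) != (c \in R).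
      by move=> eE /(covering_new covF eE) [R /FF]; exists R.
    have old' e c : e \notin E2 -> c \in E2 ->
        exists2 R, R \in [set a] |: F & (e \in R) != (c \in R).
      by move=> /old H /H [R RF]; exists R; rewrite // eq_sym.
    move=> e e'; rewrite !inE => /or3P He /or3P He'.
    case: He => [/eqP ->|/eqP ->|eE]; case: He' => [/eqP ->|/eqP ->|e'E] ne;
      (try by rewrite eqxx in ne); (try exact: old); (try exact: old').
    * by exists [set a]; rewrite ?setU11 // !inE eqxx (eq_sym b) (negPf ab).
    * by exists [set a]; rewrite ?setU11 // !inE eqxx (eq_sym b) (negPf ab).
    by have [R RF] := sF _ _ eE e'E ne; exists R; first exact: FF.
  + by apply: leq_trans (card_setU1_leq _ _) _;
      apply: (@leq_trans (2 * t).+1) => //; rewrite Dt leq_divRL //; clear; lia.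
Qed.

End Grown.

(** * Bounds for trees *)

Section Trees.
Variable G : sgraph.

Lemma connected_closed (A : {set G}) x : connected G -> x \in A ->
  (forall u v, u \in A -> adj u v -> v \in A) -> A = setT.
Proof.
move=> cG xA clA; apply/setP => y; rewrite inE.
have /connectP [p xp ->] := cG x y.
elim: p x xA xp {y} => [//|z p IH] x xA /= /andP [xz zp].
exact: IH (clA _ _ xA xz) zp.
Qed.

(** While a vertex is missing, connectedness gives an edge leaving [s], whose outer end is added as
    a leaf; [k] bounds the number of missing vertices. *)
Lemma connected_grown : 0 < #|G| -> connected G ->
  exists s E, grown s E /\ forall x : G, x \in s.
Proof.
move=> /card_gt0P [r _] cG.
suff main : forall (k : nat) s E, @grown G s E -> #|G| - size s <= k ->
    exists s E, @grown G s E /\ forall x : G, x \in s.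
  exact: main (Grown1 r) (leqnn _).
elim=> [|k IH] s E g szs.
  exists s, E; split=> // x; apply: contraT => xs.
  move: szs; rewrite leqn0 subn_eq0 leqNgt => /negP[]; rewrite -/(size (x :: s)).
  have /card_uniqP <- : uniq (x :: s) by rewrite /= xs (grown_uniq g).
  exact: max_card.
have [all_s|/forallPn [x xs]] := boolP [forall x, x \in s].
  by exists s, E; split=> // x; exact/forallP.
have [/existsP [u /existsP [v /and3P [us vs uv]]]|no] :=
  boolP [exists u, exists v, [&& u \notin s, v \in s & adj u v]].
  by apply: IH (GrownS g us vs uv) _; rewrite /= leq_subLR addSnnS -leq_subLR.
have [y ys] : exists y, y \in s by case: g => *; eexists; exact: mem_head.
have : [set y in s] = setT.
  apply: (connected_closed (x := y)) => //; first by rewrite inE.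
  move=> u v; rewrite !inE => us uv; apply: contraNT no => vs.
  by apply/existsP; exists v; apply/existsP; exists u; rewrite vs us adj_sym.
by move/setP/(_ x); rewrite !inE (negPf xs).
Qed.

(** An edge outside [E] would close the walk between its ends to a cycle. *)
Lemma acyclic_grown s E : acyclic G -> grown s E -> (forall x : G, x \in s) ->
  E = edges G.
Proof.
move=> aG g all_s; apply/eqP; rewrite eqEsubset (grown_edges g).
apply/subsetP => e /edgesP [[u v] /= uv ->]; apply: contraT => nE.
have [t [[ut _ tE] lt]] := grown_connect g (all_s u) (all_s v).
(* A cycle needs three vertices, so walks with no edge or one edge are excluded first. *)
case: t ut tE lt => [|w t] ut tE /= lt.
  by rewrite lt adj_irr in uv.
case: t ut tE lt => [|w' t] ut tE lt.
  by move: nE; rewrite -lt tE // mem_head.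
have /negP[] := aG [:: u, w, w' & t] ut isT.
rewrite /cycle rcons_path; apply/andP; split.
  by apply: edge_seq_path => e' /tE; apply: (subsetP (grown_edges g)).
by rewrite adj_sym [last _ _]lt.
Qed.

Lemma tree_grown : is_tree G ->
  exists2 s, grown s (edges G) & size s = #|G|.
Proof.
move=> [G0 [cG aG]]; have [s [E [g all_s]]] := connected_grown G0 cG.
exists s; first by rewrite -(acyclic_grown aG g all_s).
by rewrite -(card_uniqP (grown_uniq g)); apply: eq_card => x; rewrite all_s.
Qed.

Lemma f_le (F : {set {set {set G}}}) : separating_path_system F -> f G <= #|F|.
Proof.
move=> sF; rewrite /f; case: ex_minnP => m _; apply.
by apply/asboolP; exists F.
Qed.

Lemma f_ex : exists2 F : {set {set {set G}}}, separating_path_system F & #|F| = f G.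
Proof. by rewrite /f; case: ex_minnP => m /asboolP [F [? ?]] _; exists F. Qed.

Lemma tree_f_le : is_tree G -> f G <= (2 * (#|G| - 1)) %/ 3.
Proof.
move=> tG; have [s g <-] := tree_grown tG.
have [F [pF sF Fn]] := grown_separating g.
by apply: leq_trans Fn; apply: f_le; split=> // P /pF [].
Qed.

(** * Degrees and ends of paths *)

Definition inc (u : G) := [set e in edges G | u \in e].
Definition deg (u : G) := #|inc u|.
(* For a path with at least one edge, these are its two end vertices. *)
Definition ends (P : {set {set G}}) := [set u | #|P :&: inc u| == 1].

Lemma in_inc u e : (e \in inc u) = (e \in edges G) && (u \in e).
Proof. by rewrite inE. Qed.

Lemma sum_deg : is_tree G -> \sum_(u : G) deg u = 2 * (#|G| - 1).
Proof.
move=> /tree_grown [s g sz].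
have -> : \sum_u deg u = \sum_(u : G) \sum_(e in edges G) (u \in e : nat).
  apply: eq_bigr => u _; rewrite /deg -sum1_card big_mkcond /= [RHS]big_mkcond /=.
  by apply: eq_bigr => e _; rewrite inE; do 2!case: (_ \in _).
rewrite exchange_big /=.
have -> : \sum_(e in edges G) \sum_(u : G) (u \in e : nat) = \sum_(e in edges G) 2.
  apply: eq_bigr => e /edgesP [[x y] /= xy ->].
  rewrite -(big_mkcond (fun u => u \in [set x; y]) (fun _ => 1)) sum1_card cards2.
  by case: eqP xy => [->|//]; rewrite adj_irr.
by rewrite sum_nat_const -sz -(card_grown g) subn1 mulnC.
Qed.

(** An inner vertex of the path lies on two of its edges, the one before it and the one after it. *)
Lemma card_ends P : is_path P -> #|ends P| <= 2.
Proof.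
case=> x [s [us xs ->]].
suff sub : ends (seq_edges (x :: s)) \subset [set x; last x s].
  by apply: leq_trans (subset_leq_card sub) _; rewrite cards2; case: eqP.
apply/subsetP => v; rewrite !inE => /cards1P [e0 E0].
have : e0 \in seq_edges (x :: s) :&: inc v by rewrite E0 inE.
rewrite in_setI in_inc mem_seq_edges => /andP [e0s /andP [_ ve0]].
have := edge_seq_sub e0s ve0; rewrite inE => /orP [->//|vs].
apply: contraT; rewrite negb_or => /andP [vx vl].
case/splitPr: vs E0 us xs vl {e0s ve0} => p1 p2.
case: p2 => [|w p2]; first by rewrite last_cat /= eqxx.
case/lastP El : (x :: p1) => [//|p u] E0 us xs _.
have Es : x :: p1 ++ [:: v, w & p2] = p ++ [:: u, v, w & p2].
  by rewrite -cat_cons El cat_rcons.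
have in1 : [set u; v] \in seq_edges (x :: p1 ++ [:: v, w & p2]) :&: inc v.
  rewrite in_setI in_inc set22 andbT mem_seq_edges (path_edge_seq xs) ?andbT;
  by rewrite Es edge_seq_cat mem_cat mem_head orbT.
have in2 : [set v; w] \in seq_edges (x :: p1 ++ [:: v, w & p2]) :&: inc v.
  rewrite in_setI in_inc set21 andbT mem_seq_edges (path_edge_seq xs) ?andbT;
  by rewrite Es -cat_rcons edge_seq_cat mem_cat mem_head orbT.
move: in1 in2; rewrite E0 !inE => /eqP <- /eqP /set2_inj.
move: us; rewrite Es cat_uniq => /and3P [_ _].
rewrite /= !inE !negb_or => /and4P [/and3P [uv uw _] _ _ _].
by case=> -[? ?]; subst; rewrite eqxx in uv uw.
Qed.

End Trees.

(** * Counting path ends at leaves and at vertices of degree 2 *)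

Section LowerBound.
Variables (G : sgraph) (F : {set {set {set G}}}).
Hypotheses (cG : connected G) (G3 : 3 <= #|G|) (sepF : separating_path_system F).
Implicit Types (u v w : G) (P : {set {set G}}).

(** At a leaf this is the set of paths containing its only edge, that is, the code of that edge. *)
Definition ending u := [set P in F | u \in ends P].
Definition single := [set u : G | (deg u == 1) && (#|ending u| == 1)].
Definition missed := [set u : G | (deg u == 1) && (#|ending u| == 0)].

(** Serves to exclude that an isolated vertex or a single edge is a whole component. *)
Lemma inc_closed (A : {set G}) x : x \in A ->
  (forall u e, u \in A -> e \in inc u -> e \subset A) -> 3 <= #|A|.
Proof.
move=> xA clA; rewrite (_ : A = setT) ?cardsT //.
apply: connected_closed cG xA _ => u v uA uv.
apply: (subsetP (clA u [set u; v] uA _)); last by rewrite set22.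
by rewrite inE mem_edges uv set21.
Qed.

Lemma card_cover3 (x y z : G) (A : {set G}) :
  A \subset [set x; y; z] -> #|A| <= 3.
Proof.
move=> /subset_leq_card /leq_trans; apply.
by rewrite -setUA cardsU1 cards2; do 2!case: (_ \notin _) || case: (_ != _).
Qed.

Lemma sepP e1 e2 : e1 \in edges G -> e2 \in edges G ->
  (forall P, P \in F -> (e1 \in P) = (e2 \in P)) -> e1 = e2.
Proof.
move=> h1 h2 H; apply/eqP; apply: contraT => ne.
by have [P PF] := sepF.2 _ _ h1 h2 ne; rewrite H // eqxx.
Qed.

Lemma ends_leaf u e P : inc u = [set e] -> P \in F -> (u \in ends P) = (e \in P).
Proof.
move=> iu PF; rewrite inE iu; case: (boolP (e \in P)) => eP.
  by rewrite (setIidPr _) ?cards1 // sub1set.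
rewrite (_ : _ :&: _ = set0) ?cards0 //; apply/setP => x; rewrite !inE.
by case: eqP => [->|_]; rewrite ?(negPf eP) ?andbF.
Qed.

Lemma inc_edge u e : e \in inc u -> e \in edges G /\ u \in e.
Proof. by rewrite inE => /andP []. Qed.

(** Their edges have equal codes, hence coincide; an edge with two distinct leaves as ends would be
    a component. *)
Lemma leaf_twin u w : deg u = 1 -> deg w = 1 -> ending u = ending w -> u = w.
Proof.
move=> /eqP/cards1P [e iu] /eqP/cards1P [e' iw] Euw.
have [eE ue] : e \in edges G /\ u \in e by apply: inc_edge; rewrite iu inE.
have [e'E we'] : e' \in edges G /\ w \in e' by apply: inc_edge; rewrite iw inE.
have ee' : e = e'.
  apply: sepP => // P PF; rewrite -(ends_leaf iu PF) -(ends_leaf iw PF).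
  by move/setP/(_ P): Euw; rewrite !inE PF.
subst e'; apply/eqP; apply: contraT => uw.
have [v uv ev] := edges_at eE ue.
have wv : w = v by move: we'; rewrite ev !inE eq_sym (negPf uw) => /eqP.
subst w.
suff: 3 <= #|e| by rewrite ev cards2 uw.
apply: inc_closed ue _ => z a; rewrite {1}ev in_set2 => /orP [] /eqP ->.
  by rewrite iu inE => /eqP ->.
by rewrite iw inE => /eqP ->.
Qed.

Lemma deg_gt0 u : 0 < deg u.
Proof.
rewrite lt0n cards_eq0; apply: contraT => /negPn /eqP iu.
suff: 3 <= #|[set u]| by rewrite cards1.
apply: inc_closed (set11 u) _ => v e; rewrite in_set1 => /eqP ->.
by rewrite iu inE.
Qed.

(** A path separating the two edges at [u] contains exactly one of them, so it ends at [u]. *)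
Lemma ending_gt0 u : deg u = 2 -> 0 < #|ending u|.
Proof.
move=> /eqP/cards2P [e1 [e2 [ne iu]]].
have [e1E _] : e1 \in edges G /\ u \in e1 by apply: inc_edge; rewrite iu set21.
have [e2E _] : e2 \in edges G /\ u \in e2 by apply: inc_edge; rewrite iu set22.
have [P PF dP] := sepF.2 _ _ e1E e2E ne.
apply/card_gt0P; exists P; rewrite !inE PF iu /=.
apply/cards1P; case: (boolP (e1 \in P)) dP => [e1P|e1P] e2P.
  exists e1; apply/setP => e; rewrite !inE; case: (eqVneq e e1) => [->|_].
    by rewrite e1P.
  by case: eqP => [->|]; rewrite ?andbF //; case: (e2 \in P) e2P.
exists e2; apply/setP => e; rewrite !inE orbC; case: (eqVneq e e2) => [->|_].
  by move: e2P; case: (e2 \in P).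
by case: eqP => [->|]; rewrite ?andbF // (negPf e1P).
Qed.

(** [ending] is injective on leaves. The set [A] is [F] at first, and later [F] without one path. *)
Lemma card_single_le (A : {set {set {set G}}}) :
  (forall u, u \in single -> exists2 P, P \in A & ending u = [set P]) ->
  #|single| <= #|A|.
Proof.
move=> H; rewrite -(card_in_imset (f := ending)); last first.
  move=> u w; rewrite !inE => /andP [/eqP du _] /andP [/eqP dw _].
  exact: leaf_twin.
apply: leq_trans (leq_imset_card set1 A); apply: subset_leq_card.
apply/subsetP => X /imsetP [u us ->]; have [P PA ->] := H _ us.
exact: imset_f.
Qed.

Lemma card_single : #|single| <= #|F|.
Proof.
apply: card_single_le => u; rewrite inE => /andP [_ /cards1P [P Pu]].
exists P => //; have : P \in ending u by rewrite Pu inE.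
by rewrite inE => /andP [].
Qed.

Lemma card_missed : #|missed| <= 1.
Proof.
apply/card_le1_eqP => u w; rewrite !inE !cards_eq0.
move=> /andP [/eqP du /eqP eu] /andP [/eqP dw /eqP ew].
by apply: leaf_twin; rewrite // eu ew.
Qed.

Lemma card_sum (A : {set G}) : #|A| = \sum_(u : G) (u \in A).
Proof. by rewrite -sum1_card big_mkcond; apply: eq_bigr => u _; case: (u \in A). Qed.

Lemma sum_ending : \sum_(u : G) #|ending u| <= 2 * #|F|.
Proof.
have -> : \sum_(u : G) #|ending u| = \sum_(u : G) \sum_(P in F) (u \in ends P : nat).
  apply: eq_bigr => u _; rewrite -sum1_card big_mkcond /= [RHS]big_mkcond /=.
  by apply: eq_bigr => P _; rewrite inE; do 2!case: (_ \in _).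
rewrite exchange_big /= mulnC -sum_nat_const; apply: leq_sum => P PF.
by rewrite -card_sum; apply: card_ends; apply: sepF.1.
Qed.

Lemma leaf_count :
  2 * #|[set u : G | deg u == 1]| + #|[set u : G | deg u == 2]| <= 3 * #|F| + 2.
Proof.
suff: 2 * #|[set u : G | deg u == 1]| + #|[set u : G | deg u == 2]|
    <= \sum_(u : G) #|ending u| + #|single| + 2 * #|missed|.
  move: sum_ending card_single card_missed.
  move: (\sum_u _) #|F| #|single| #|missed| (2 * _ + _); clear; lia.
(* The inequality holds vertex by vertex: the corrections lift every leaf to at least 2. *)
rewrite !card_sum !big_distrr -!big_split /=; apply: leq_sum => u _.
rewrite !inE; case: (eqVneq (deg u) 1) => [-> //=|d1].
  by case: #|ending u| => [|[|k]] //=; lia.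
by case: (eqVneq (deg u) 2) => [/ending_gt0|] //=; lia.
Qed.

(* If v is the neighbour of the missed leaf, then v has degree 2 in the last
   case, and its other edge has the code of the unique path P ending at v; so
   no leaf is the end of P only. *)
Lemma missed_slack u : 4 <= #|G| -> u \in missed ->
  (exists v, 4 <= deg v + #|ending v|) \/ #|single| < #|F|.
Proof.
move=> G4; rewrite inE cards_eq0 => /andP [/cards1P [e iu] /eqP eu].
have [eE ue] : e \in edges G /\ u \in e by apply: inc_edge; rewrite iu inE.
have eF P : P \in F -> e \notin P.
  move=> PF; rewrite -(ends_leaf iu PF); apply/negP => uP.
  by have : P \in ending u by [rewrite inE PF]; rewrite eu inE.
have [v uv ev] := edges_at eE ue.
have ev' : e \in inc v by rewrite inE eE ev set22.
have u_v : u != v by apply: contraTneq uv => ->; rewrite adj_irr.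
have [d4|d4] := leqP 4 (deg v); first by left; exists v; apply: ltn_addr.
have e1 : #|inc v| = #|inc v :\ e|.+1 by rewrite (cardsD1 e) ev'.
have iv : inc v = e |: (inc v :\ e) by rewrite setD1K.
have d2 : deg v != 1.
  apply: contraTneq G4 => /eqP/cards1P [e' iv'].
  suff: 3 <= #|e| by rewrite ev cards2 u_v.
  apply: inc_closed ue _ => w a; rewrite {1}ev in_set2 => /orP [] /eqP ->.
    by rewrite iu inE => /eqP ->.
  by move: ev'; rewrite iv' !inE => /eqP <- /eqP ->.
(* In degree 3, a path separating the two other edges at [v] avoids [e], so it ends at [v]. *)
case: (eqVneq (deg v) 3) => [d3|d3].
  have : #|inc v :\ e| == 2 by rewrite -eqSS -e1 -/(deg v) d3.
  case/cards2P => [a [b [ab Dv]]].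
  have [aE _] : a \in edges G /\ v \in a.
    by apply: inc_edge; rewrite iv Dv !inE eqxx orbT.
  have [bE _] : b \in edges G /\ v \in b.
    by apply: inc_edge; rewrite iv Dv !inE eqxx !orbT.
  have [P PF dP] := sepF.2 _ _ aE bE ab.
  left; exists v; rewrite d3 -addn1 leq_add2l; apply/card_gt0P; exists P.
  rewrite !inE PF iv Dv /=; apply/cards1P.
  exists (if a \in P then a else b); apply/setP => x; rewrite !inE.
  case: (eqVneq x e) => [->|xe].
    rewrite (negPf (eF _ PF)); apply/esym/eqP => ee.
    by move: (eF _ PF); rewrite ee; move: dP; case: ifP; case: (b \in P) => //= ->.
  case: (eqVneq x a) => [->|xa] /=.
    by case: ifP => aP; rewrite ?eqxx ?aP ?(negPf ab).
  case: (eqVneq x b) => [->|xb] /=; last first.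
    by case: ifP; rewrite ?(negPf xa) ?(negPf xb) andbF.
  by move: dP; case: ifP; case: (b \in P); rewrite ?eqxx ?(eq_sym b a) ?(negPf ab).
have {d2 d3} d2 : deg v = 2 by move: d2 d3 d4 (deg_gt0 v); case: (deg v) => [|[|[|[]]]].
have : #|inc v :\ e| == 1 by rewrite -eqSS -e1 -/(deg v) d2.
case/cards1P => e' Dv.
have [e'E ve'] : e' \in edges G /\ v \in e'.
  by apply: inc_edge; rewrite iv Dv !inE eqxx orbT.
have ee' : e' != e by have := setD11 e (inc v); rewrite Dv inE eq_sym => ->.
have endv P : P \in F -> (v \in ends P) = (e' \in P).
  move=> PF; rewrite inE iv Dv setIUr (_ : P :&: [set e] = set0) ?set0U; last first.
    by apply/setP => x; rewrite !inE; case: eqP => [->|]; rewrite ?andbF //;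
      rewrite (negPf (eF _ PF)).
  case: (boolP (e' \in P)) => e'P.
    by rewrite (setIidPr _) ?cards1 // sub1set.
  rewrite (_ : _ :&: _ = set0) ?cards0 //; apply/setP => x; rewrite !inE.
  by case: eqP => [->|_]; rewrite ?(negPf e'P) ?andbF.
have [c2|c2] := leqP 2 #|ending v|; first by left; exists v; rewrite d2.
have /cards1P [P0 E0] : #|ending v| == 1 by rewrite eqn_leq -ltnS c2 ending_gt0.
have P0F : P0 \in F.
  by have : P0 \in ending v; [rewrite E0 inE | rewrite inE => /andP []].
right; rewrite (cardsD1 P0) P0F ltnS; apply: card_single_le => w.
rewrite inE => /andP [/cards1P [a iw] /cards1P [P EP]]; exists P => //.
have : P \in ending w by rewrite EP inE.
rewrite !inE => /andP [-> _]; rewrite andbT; apply/eqP => PP0; subst P.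
have [aE wa] : a \in edges G /\ w \in a by apply: inc_edge; rewrite iw inE.
have ae' : a = e'.
  apply: sepP => // P PF; rewrite -(ends_leaf iw PF) -endv //.
  by have /setP/(_ P) : ending w = ending v; [rewrite EP E0 | rewrite !inE PF].
subst a; have wv : w != v.
  by apply/eqP => wv; move: d2; rewrite -wv /deg iw cards1.
have [x vx ex] := edges_at e'E ve'.
have xw : x = w by move: wa; rewrite ex !inE (negPf wv) => /eqP.
(* Now [u], [v], [w] form a path that is a whole component, against [4 <= #|G|]. *)
subst x; move: G4; rewrite leqNgt ltnS; case/negP.
rewrite -cardsT -(_ : [set u; v; w] = setT); first exact: card_cover3 (subxx _).
apply: connected_closed cG (_ : u \in _) _; first by rewrite !inE eqxx.
have sub (y z : G) (a : {set {set G}}) : adj y z -> inc y = a -> [set y; z] \in a.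
  by move=> yz <-; rewrite inE mem_edges yz set21.
move=> y z; rewrite !inE -orbA => /or3P [] /eqP -> yz.
- have := sub _ _ _ yz iu; rewrite inE ev => /eqP /set2_inj [[_ ->]|[<- ->]];
  by rewrite eqxx ?orbT.
- have := sub _ _ _ yz iv; rewrite Dv !inE ev ex.
  by case/orP=> /eqP /set2_inj [[_ ->]|[? ->]]; rewrite ?eqxx ?orbT.
- have := sub _ _ _ yz iw; rewrite inE ex => /eqP /set2_inj [[? ->]|[_ ->]];
  by rewrite eqxx ?orbT.
Qed.

(** Summing [slack] over the n vertices gives n + 2 <= 3 |F| if no leaf is missed, and only n <= 3
    |F| otherwise; then [missed_slack] supplies one more unit. *)
Lemma card_system_ge : is_tree G -> 4 <= #|G| -> #|G| + 1 <= 3 * #|F|.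
Proof.
move=> tG G4.
have slack u : 3 <= deg u + #|ending u| + (u \in single) + 2 * (u \in missed).
  rewrite !inE; case: (deg u) (deg_gt0 u) (@ending_gt0 u) => [|[|[|k]]] //= _.
  - by case: #|ending u| => [|[|k]] //=; clear; lia.
  - by move=> /(_ erefl); clear; lia.
have sums (g : G -> nat) :
    (forall u, g u <= deg u + #|ending u| + (u \in single) + 2 * (u \in missed)) ->
    \sum_(u : G) g u <= 2 * (#|G| - 1) + 2 * #|F| + #|single| + 2 * #|missed|.
  move=> H; apply: (@leq_trans (\sum_(u : G)
    (deg u + #|ending u| + (u \in single) + 2 * (u \in missed)))).
    by apply: leq_sum => u _; apply: H.
  rewrite (card_sum single) (card_sum missed) big_distrr /= !big_split /=.
  rewrite (sum_deg tG) !leq_add2r leq_add2l.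
  exact: sum_ending.
have sum3 : \sum_(u : G) 3 = 3 * #|G| by rewrite sum_nat_const mulnC.
have base := sums (fun=> 3) slack; rewrite sum3 in base.
have [m0|/card_gt0P [u um]] := posnP #|missed|.
  move: base card_single G4; rewrite m0.
  by move: #|F| #|single| #|G|; clear; lia.
case: (missed_slack G4 um) => [[v v4]|sF].
  (* The vertex [v] contributes 4 instead of 3. *)
  have := sums (fun u => 3 + (u == v)); rewrite big_split sum3 /=.
  have -> : \sum_(u : G) (u == v : nat) = 1.
    by rewrite (bigD1 v) //= eqxx big1 // => w /negPf ->.
  move=> /(_ _) H; have {}H := H ltac:(by move=> w; case: eqP => [->|_];
    [apply: leq_trans v4 _; rewrite -addnA leq_addr | rewrite addn0; exact: slack]).
  move: H card_single card_missed G4.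
  by move: #|F| #|single| #|G| #|missed|; clear; lia.
move: base card_missed sF G4.
by move: #|F| #|single| #|G| #|missed|; clear; lia.
Qed.

End LowerBound.

(** Adding 2 before the division by 3 rounds up. *)
Lemma tree_f_ge (G : sgraph) : is_tree G -> 4 <= #|G| ->
  (#|G| + 1 + 2) %/ 3 <= f G.
Proof.
move=> tG G4; have [F sF <-] := f_ex G.
have := card_system_ge (proj1 (proj2 tG)) (ltnW G4) sF tG G4.
move=> H; rewrite -ltnS ltn_divLR // mulSn mulnC addnC -addSnnS.
by move: H; move: #|F| #|G|; clear; lia.
Qed.

(** * Extremal trees *)

Section ParentGraph.
Variables (p : nat -> nat) (n : nat).
Hypothesis p_lt : forall x, 0 < x -> p x < x.
Implicit Types x y z : 'I_n.+1.

Definition parent_adj x y := (0 < x) && (p x == y) || (0 < y) && (p y == x).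

Lemma parent_adj_sym : symmetric parent_adj.
Proof. by move=> x y; rewrite /parent_adj orbC. Qed.

Lemma parent_adj_irr : irreflexive parent_adj.
Proof.
move=> x; rewrite /parent_adj orbb; case: posnP => //= /p_lt.
by case: eqP => // ->; rewrite ltnn.
Qed.

Definition parent_graph := SGraph parent_adj_sym parent_adj_irr.

(** For positive [x] the value [p x] is in range; at the root [inord] may fall back to 0. *)
Definition parent x : 'I_n.+1 := inord (p x).
Definition parent_edge x : {set parent_graph} := [set (x : parent_graph); parent x].

Lemma val_parent x : 0 < x -> parent x = p x :> nat.
Proof.
move=> x0; rewrite inordK //; apply: ltn_trans (p_lt x0) _.
exact: ltn_ord.
Qed.

Lemma adj_parent x : 0 < x -> parent_adj x (parent x).
Proof. by move=> x0; rewrite /parent_adj x0 val_parent // eqxx. Qed.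

Lemma parent_ltn x : 0 < x -> parent x < x.
Proof. by move=> x0; rewrite val_parent // p_lt. Qed.

Lemma parent_adj_lt x y : parent_adj x y -> y < x -> y = parent x.
Proof.
case/orP => /andP [x0 /eqP E] yx; first by apply/val_inj; rewrite /= val_parent.
by have := p_lt x0; rewrite E ltnNge ltnW.
Qed.

Lemma parent_edges e : e \in edges parent_graph ->
  exists2 x : 'I_n.+1, 0 < x & e = parent_edge x.
Proof.
case/edgesP => -[x y] /= xy ->.
have [yx|xy'|/val_inj xy'] := ltngtP y x.
- by exists x; [apply: leq_ltn_trans yx | rewrite (parent_adj_lt xy yx)].
- exists y; first by apply: leq_ltn_trans xy'.
  rewrite parent_adj_sym in xy.
  by rewrite /parent_edge -(parent_adj_lt xy xy') setUC.
- by rewrite xy' parent_adj_irr in xy.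
Qed.

Lemma parent_edge_inj x y : 0 < x -> 0 < y -> parent_edge x = parent_edge y -> x = y.
Proof.
move=> x0 y0 /(@set2_inj parent_graph) [[] //|[xy yx]].
have := parent_ltn x0; rewrite yx => lt1.
by have := parent_ltn y0; rewrite -xy ltnNge ltnW.
Qed.

Lemma parent_graph_tree : is_tree parent_graph.
Proof.
split; first by rewrite card_ord.
split.
  have to0 k : forall x, x <= k -> connect parent_adj x ord0.
    elim: k => [|k IH] x xk.
      by rewrite (_ : x = ord0) //; apply/val_inj/eqP; rewrite /= -leqn0.
    have [x0|x0] := posnP x; first by apply: IH; rewrite x0.
    apply: connect_trans (connect1 (adj_parent x0)) _; apply: IH.
    by rewrite -ltnS; apply: leq_trans (parent_ltn x0) xk.
  move=> x y; apply: connect_trans (to0 _ x (leqnn x)) _.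
  by rewrite (sym_connect_sym parent_adj_sym) (to0 _ y (leqnn y)).
move=> s us s3; apply/negP => cs.
have [x0 x0s] : exists x : 'I_n.+1, x \in (s : seq 'I_n.+1).
  by case: s s3 {us cs} => // x s _; exists x; rewrite mem_head.
(* Both neighbours on the cycle of its largest vertex are smaller, so both equal its parent. *)
have [x xs xmax] : exists2 x : 'I_n.+1, x \in (s : seq 'I_n.+1)
    & forall y : 'I_n.+1, y \in (s : seq 'I_n.+1) -> y <= x.
  by case: (@arg_maxnP _ x0 (mem (s : seq 'I_n.+1)) val x0s) => x; exists x.
have [i t Et] := rot_to xs.
move: cs us s3; rewrite -(rot_cycle i) -(rot_uniq i) -(size_rot i) Et.
have tmax y : y \in t -> y <= x.
  by move=> yt; apply: xmax; rewrite -(mem_rot i) Et inE yt orbT.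
case: t {Et} tmax => [//|y t]; case/lastP: t => [//|t z] tmax.
rewrite /cycle rcons_path /= last_rcons => /andP [/andP [xy _] zx].
rewrite parent_adj_sym in zx.
rewrite !(inE, mem_rcons) !negb_or.
case/and3P => [/and3P [x_y x_z _] /andP [/negP y_z _] _] _.
have zt : z \in y :: rcons t z by rewrite inE mem_rcons mem_head orbT.
have below (w : 'I_n.+1) : w \in y :: rcons t z -> x != w -> w < x.
  by move=> /tmax wx x_w; rewrite ltn_neqAle wx andbT eq_sym.
have ey := parent_adj_lt xy (below _ (mem_head _ _) x_y).
have ez := parent_adj_lt zx (below _ zt x_z).
by apply: y_z; apply/eqP; exact: etrans ey (esym ez).
Qed.

Definition climb x t := seq_edges ((x : parent_graph) :: traject parent (parent x) t).

Lemma edge_seq_climb x t : @edge_seq parent_graph (x :: traject parent (parent x) t)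
  = [seq parent_edge z | z <- traject parent x t].
Proof. by elim: t x => [//|t IH] x; rewrite trajectS edge_seq_cons IH. Qed.

(** Naming each edge by its child end turns the edges of a climb into a list of vertices. *)
Lemma mem_climb x t z : {in traject parent x t, forall y, 0 < y} -> 0 < z ->
  (parent_edge z \in climb x t) = (z \in traject parent x t).
Proof.
move=> pos z0; rewrite mem_seq_edges edge_seq_climb.
apply/mapP/idP => [[y yt /parent_edge_inj ->]|zt] //; first exact: pos.
by exists z.
Qed.

Lemma climb_is_path x t : {in traject parent x t, forall y, 0 < y} ->
  is_path (climb x t).
Proof.
move=> pos; exists x, (traject parent (parent x) t); split=> //; last first.
  elim: t x pos => [//|t IH] x pos; rewrite trajectS /=.
  rewrite [_ && _]andbC IH ?adj_parent ?pos ?mem_head //.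
  by move=> y yt; apply: pos; rewrite inE yt orbT.
elim: t x pos => [//|t IH] x pos; rewrite trajectS cons_uniq.
have pos' : {in traject parent (parent x) t, forall y, 0 < y}.
  by move=> y yt; apply: pos; rewrite trajectS inE yt orbT.
rewrite IH // andbT -trajectS.
have x0 : 0 < x by apply: pos; rewrite trajectS mem_head.
suff lt y : y \in traject parent (parent x) t.+1 -> y <= parent x.
  by apply/negP => /lt; rewrite leqNgt parent_ltn.
elim: t (parent x) pos' {IH pos x0} => [|t IH] u pos'.
  by rewrite inE => /eqP ->.
rewrite trajectS inE => /orP [/eqP -> //|/IH le].
have u0 : 0 < u by apply: pos'; rewrite trajectS mem_head.
apply: leq_trans (ltnW (parent_ltn u0)); apply: le => v vt.
by apply: pos'; rewrite trajectS inE vt orbT.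
Qed.

End ParentGraph.

Arguments parent p {n} x.

(** * Stars, attaining the upper bound *)

Lemma star_parent_lt x : 0 < x -> (fun=> 0) x < x.
Proof. by []. Qed.

Definition star n := parent_graph n star_parent_lt.

Lemma star_leaf n (x : 'I_n.+1) : 0 < x -> @deg (star n) x = 1.
Proof.
move=> x0; apply/eqP/cards1P; exists (parent_edge star_parent_lt x).
apply/setP => e; rewrite in_inc in_set1.
apply/andP/eqP => [[/parent_edges [z z0 ->]]|->]; last first.
  by rewrite set21 mem_edges; split=> //; apply: adj_parent.
rewrite in_set2 => /orP [/eqP -> //|/eqP E]; exfalso.
by move: x0; rewrite E inordK.
Qed.

(** With 3s + 1 leaves, [leaf_count] gives 6s + 2 <= 3 |F| + 2, so |F| >= 2s, the rounded-down
    bound. *)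
Lemma star_f t : f (star (3 * t.+1 + 1)) = (2 * (#|star (3 * t.+1 + 1)| - 1)) %/ 3.
Proof.
set G := star _; have tG : is_tree G := parent_graph_tree _ _.
have cG : #|G| = 3 * t.+1 + 2 by rewrite card_ord addn2 addn1.
apply/eqP; rewrite eqn_leq tree_f_le //=.
have [F sF <-] := f_ex G.
have := leaf_count (proj1 (proj2 tG)) _ sF; rewrite cG => /(_ ltac:(lia)).
have : 3 * t.+1 + 1 <= #|[set u : G | deg u == 1]|.
  have <- : #|~: [set ord0 : G]| = 3 * t.+1 + 1.
    by rewrite cardsC1 cG; lia.
  apply: subset_leq_card; apply/subsetP => x; rewrite !inE => x0.
  by rewrite star_leaf // lt0n.
move: #|_| #|_| #|F| => a b c h1 h2.
by rewrite -ltnS ltn_divLR //; lia.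
Qed.

(* The spine is 0, ..., 2k - 2, and the vertex 2k - 2 + i with 0 < i < k is a
   leaf attached to the spine vertex 2k - 2 - i.  The i-th path climbs from
   2k - 2 + i down to the spine vertex k - 2 - i, or to 0 when this truncates. *)
Section Caterpillar.
Variable k : nat.
Hypothesis k2 : 2 <= k.

Definition cat_parent x := if x <= 2 * k - 2 then x.-1 else 4 * k - 4 - x.

Lemma cat_parent_lt x : 0 < x -> cat_parent x < x.
Proof. rewrite /cat_parent; case: ifP; lia. Qed.

Definition caterpillar := parent_graph (3 * k - 3) cat_parent_lt.
Implicit Types (i : nat) (x y z : 'I_(3 * k - 3).+1).

Definition cat_start i : 'I_(3 * k - 3).+1 := inord (2 * k - 2 + i).
Definition cat_top i := cat_parent (2 * k - 2 + i).
Definition cat_low i := k - 2 - i.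
Definition cat_path i :=
  climb cat_parent_lt (cat_start i) (cat_top i - cat_low i).+1.

Definition cat_code i (x : nat) :=
  (x == 2 * k - 2 + i) || (cat_low i < x <= cat_top i).

Lemma mem_spine x t z : x <= 2 * k - 2 -> t <= x ->
  (z \in traject (parent cat_parent) x t) = (x - t < z <= x).
Proof.
elim: t x => [|t IH] x xk tx; first by rewrite subn0 ltnNge andNb.
have x0 : 0 < x by lia.
have px : parent cat_parent x = x.-1 :> nat.
  by rewrite (val_parent cat_parent_lt) // /cat_parent xk.
rewrite trajectS inE IH px; [|lia|lia].
by rewrite -val_eqE /=; lia.
Qed.

Lemma mem_cat_traject i z : i < k ->
  (z \in traject (parent cat_parent) (cat_start i) (cat_top i - cat_low i).+1)
  = cat_code i z.
Proof.
move=> ik.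
have vs : cat_start i = 2 * k - 2 + i :> nat by rewrite inordK //; lia.
have vt : parent cat_parent (cat_start i) = cat_top i :> nat.
  by rewrite (val_parent cat_parent_lt) vs //; lia.
have tk : cat_low i <= cat_top i <= 2 * k - 2.
  by rewrite /cat_low /cat_top /cat_parent; case: ifP; lia.
rewrite trajectS inE mem_spine vt; [|lia|lia].
rewrite -val_eqE /= vs /cat_code; congr (_ || (_ < _ <= _)); lia.
Qed.

Lemma cat_code_gt0 i (x : nat) : i < k -> cat_code i x -> 0 < x.
Proof. by rewrite /cat_code; lia. Qed.

(** A spine edge [x < k] lies on the paths [k - 1 - x] to [k - 1], a spine edge [x >= k] on the
    paths 0 to [2 * k - 2 - x], and the pendant edge [2 * k - 2 + i] with [i > 0] on path [i] only.
    These index sets are distinct. *)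
Lemma cat_code_sep (x y : nat) : 0 < x -> x < y -> y <= 3 * k - 3 ->
  exists2 i, i < k & cat_code i x != cat_code i y.
Proof.
move=> x0 xy yk.
(* Two final segments differ at the first index of the longer, two initial ones at the last; [k - 1]
   is in every final segment and in no proper initial one. The last pendant edge has code [k - 1]
   alone, so [k - 2] is used against it. *)
pose i := if y <= 2 * k - 2 then
            if y < k then k - 1 - y else if k <= x then 2 * k - 2 - x else k - 1
          else if 2 * k - 2 < x then x - (2 * k - 2)
          else if k <= x then 0
          else if y == 3 * k - 3 then k - 2 else k - 1.
exists i; rewrite /i /cat_code /cat_low /cat_top /cat_parent;
  repeat case: ifP; lia.
Qed.

Lemma caterpillar_f_le : f caterpillar <= k.
Proof.
pose F := [set cat_path i | i : 'I_k].
have pos (i : 'I_k) : {in traject (parent cat_parent) (cat_start i)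
    (cat_top i - cat_low i).+1, forall y, 0 < y}.
  by move=> y; rewrite mem_cat_traject // => /(cat_code_gt0 (ltn_ord i)).
have codeE (i : 'I_k) x : 0 < x ->
    (parent_edge cat_parent_lt x \in cat_path i) = cat_code i x.
  by move=> x0; rewrite mem_climb // mem_cat_traject.
apply: (@leq_trans #|F|); last by rewrite -[leqRHS](card_ord k) leq_imset_card.
apply: f_le; split; first by move=> P /imsetP [i _ ->]; apply: climb_is_path.
move=> _ _ /parent_edges [x x0 ->] /parent_edges [y y0 ->] ne.
have sep (u v : 'I_(3 * k - 3).+1) : 0 < u -> u < v -> exists2 P, P \in F &
    (parent_edge cat_parent_lt u \in P) != (parent_edge cat_parent_lt v \in P).
  move=> u0 uv; have [|i ik d] := cat_code_sep u0 uv; first by rewrite -ltnS.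
  exists (cat_path (Ordinal ik)); first exact: imset_f.
  by rewrite !codeE //; apply: leq_trans uv.
have [xy|yx|/val_inj xy] := ltngtP x y; first exact: sep.
  by have [P PF] := sep _ _ y0 yx; exists P; rewrite // eq_sym.
by rewrite xy eqxx in ne.
Qed.

Lemma caterpillar_f : 2 < k -> f caterpillar = (#|caterpillar| + 1 + 2) %/ 3.
Proof.
move=> k3.
have cG : #|caterpillar| = (3 * k - 3).+1 by rewrite card_ord.
(* The numerator is [3 * k + 1]. *)
have E : (#|caterpillar| + 1 + 2) %/ 3 = k.
  by rewrite cG (_ : _ + 2 = k * 3 + 1) ?divnMDl ?addn0 //; lia.
apply/eqP; rewrite eqn_leq {1}E caterpillar_f_le tree_f_ge //.
  exact: parent_graph_tree.
by rewrite cG; lia.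
Qed.

End Caterpillar.

Theorem theorem1p6 :
  (forall T : sgraph, is_tree T -> 4 <= #|T| ->
     (#|T| + 1 + 2) %/ 3 <= f T <= (2 * (#|T| - 1)) %/ 3)
  /\
  (forall m : nat, exists T : sgraph,
     [/\ is_tree T, m <= #|T|, 4 <= #|T| & f T = (#|T| + 1 + 2) %/ 3])
  /\
  (forall m : nat, exists T : sgraph,
     [/\ is_tree T, m <= #|T|, 4 <= #|T| & f T = (2 * (#|T| - 1)) %/ 3]).
Proof.
split; first by move=> T tT T4; rewrite tree_f_ge // tree_f_le.
split=> m.
  have k2 : 2 <= m.+3 by [].
  exists (caterpillar k2); split; last exact: caterpillar_f.
  - exact: parent_graph_tree.
  - by rewrite card_ord; lia.
  - by rewrite card_ord; lia.
exists (star (3 * m.+1 + 1)); split; last exact: star_f.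
- exact: parent_graph_tree.
- by rewrite card_ord; lia.
- by rewrite card_ord; lia.
Qed.
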